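(* For any finite simple graph $G$, \[\mathrm{mr}(G,\mathbb{F}_2) = \min\{c_2(G),\, 2t_2(G)\}.\]
   Context: All graphs are finite and simple. A subgraph complementation system for a graph $G=(V,E)$ is a finite collection (family) $\mathscr{C}$ of subsets of $V$ such that, for any two distinct vertices $u,v\in V$, $uv\in E$ if and only if $u$ and $v$ appear together in an odd number of sets in $\mathscr{C}$. The subgraph complementation number $c_2(G)$ is the minimum cardinality of a subgraph complementation system for $G$. A symmetric matrix over a field $\mathbb{F}$ with rows and columns indexed by $V$ fits $G$ if, for distinct $u,v$, its $(u,v)$ entry is nonzero if and only if $uv\in E$ (the diagonal is arbitrary). $\mathrm{mr}(G,\mathbb{F})$ is the minimum rank over $\mathbb{F}$ of a symmetric matrix over $\mathbb{F}$ which fits $G$. A complete tripartite graph (triclique) on a subset of $V$ is given by three pairwise disjoint, possibly empty, subsets $X,Y,Z$ of $V$; its vertex set is $X\cup Y\cup Z$ and two vertices are adjacent in it if and only if they lie in different sets among $X,Y,Z$. $t_2(G)$ is the minimum cardinality of a finite collection of complete tripartite graphs on subsets of $V$ such that each pair of distinct vertices of $V$ is adjacent in an odd number of these complete tripartite graphs if and only if it is adjacent in $G$ (i.e. the symmetric difference of their edge sets is $E$). *)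

(* Defs.v *)
From HB Require Import structures.
From mathcomp Require Import all_boot all_order all_algebra.

Set Implicit Arguments.
Unset Strict Implicit.
Unset Printing Implicit Defensive.

Import GRing.Theory.

Local Open Scope nat_scope.

Record sgraph := SGraph {
  vert :> finType;
  edge : rel vert;
  edge_sym : symmetric edge;
  edge_irrefl : irreflexive edge }.

Section OneEdgeAtATime.

(* Every edge of G, listed once as the pair of its ends in increasing rank;
   used only to show that the minima c2 and t2 below range over nonempty
   sets. *)
Variable G : sgraph.

Let oriented : pred (G * G) :=
  [pred p | edge p.1 p.2 && (enum_rank p.1 < enum_rank p.2)].

Definition edge_seq : seq (G * G) := enum oriented.

Lemma edge_seqP p : (p \in edge_seq) = edge p.1 p.2 && (enum_rank p.1 < enum_rank p.2).
Proof. by rewrite mem_enum. Qed.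

Lemma count_edge_seq (u v : G) (a : pred (G * G)) : u != v ->
  {in edge_seq, forall p, a p = (p == (u, v)) || (p == (v, u))} ->
  count a edge_seq = edge u v.
Proof.
move=> uv aE; rewrite (eq_in_count aE) => {a aE}.
have nuv : (u, v) != (v, u) by apply: contra uv => /eqP[->].
have -> : count (fun p => (p == (u, v)) || (p == (v, u))) edge_seq
        = count_mem (u, v) edge_seq + count_mem (v, u) edge_seq.
  rewrite -[RHS]count_predUI [X in _ = _ + X](@eq_count _ _ pred0) ?count_pred0.
    by rewrite addn0.
  by move=> p /=; apply/negP => /andP[/eqP-> /eqP euv]; rewrite euv eqxx in nuv.
rewrite !count_uniq_mem ?enum_uniq // !edge_seqP /= (edge_sym v u).
case: (edge u v) => //=.
case: ltngtP => // /ord_inj/enum_rank_inj euv.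
by rewrite euv eqxx in uv.
Qed.

End OneEdgeAtATime.

Section SubgraphComplementation.

Variable G : sgraph.

Definition is_scs (C : seq {set G}) : bool :=
  [forall u, forall v, (u != v) ==>
    (edge u v == odd (count (fun S : {set G} => (u \in S) && (v \in S)) C))].

Lemma scs_exists : exists n, [exists C : n.-tuple {set G}, is_scs C].
Proof.
pose C := [seq [set p.1; p.2] | p <- edge_seq G].
exists (size C); apply/existsP; exists (in_tuple C).
apply/'forall_forallP => u v; apply/implyP => uv.
rewrite /= count_map (count_edge_seq uv) ?oddb // => -[x y].
rewrite edge_seqP => /andP[/= xy _].
have nxy : x != y by apply/eqP => exy; rewrite exy edge_irrefl in xy.
rewrite !inE !xpair_eqE.
case: (eqVneq u x) (eqVneq v y) => [ux|ux] [vy|vy] /=; rewrite ?(eq_sym x) ?(eq_sym y);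
  subst; rewrite ?eqxx ?orbT ?andbT ?andbF //=; rewrite ?(negbTE uv) ?(negbTE nxy) //=;
  do ?[by rewrite eq_sym (negbTE uv)];
  by rewrite ?(negbTE ux) ?(negbTE vy) ?andbF ?andbT ?orbF ?orFb //= andbC.
Qed.

Definition c2 : nat := ex_minn scs_exists.

End SubgraphComplementation.

Section Triclique.

Variable V : finType.

Definition triclique : predArgType := ({set V} * {set V} * {set V})%type.

Definition is_triclique (t : triclique) : bool :=
  let: (X, Y, Z) := t in
  [&& [disjoint X & Y], [disjoint X & Z] & [disjoint Y & Z]].

Definition triclique_adj (t : triclique) (u v : V) : bool :=
  let: (X, Y, Z) := t in
  let between (A B : {set V}) :=
    (u \in A) && (v \in B) || (u \in B) && (v \in A) in
  [|| between X Y, between X Z | between Y Z].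

End Triclique.

Section TricliqueNumber.

Variable G : sgraph.

Definition is_triclique_system (C : seq (triclique G)) : bool :=
  all (@is_triclique G) C &&
  [forall u, forall v, (u != v) ==>
    (edge u v == odd (count (fun t => triclique_adj t u v) C))].

Lemma triclique_system_exists :
  exists n, [exists C : n.-tuple (triclique G), is_triclique_system C].
Proof.
pose C : seq (triclique G) :=
  [seq ([set p.1], [set p.2], set0) | p <- edge_seq G].
exists (size C); apply/existsP; exists (in_tuple C).
apply/andP; split=> /=.
  apply/allP => _ /mapP[[x y] + ->]; rewrite edge_seqP => /andP[/= xy _].
  have nxy : x != y by apply/eqP => exy; rewrite exy edge_irrefl in xy.
  by rewrite disjoints1 inE nxy -!setI_eq0 !setI0 eqxx.
apply/'forall_forallP => u v; apply/implyP => uv.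
rewrite count_map (count_edge_seq uv) ?oddb // => -[x y] _.
by rewrite /= !inE !andbF /= !orbF !xpair_eqE !(eq_sym u) !(eq_sym v) (andbC (y == u)).
Qed.

Definition t2 : nat := ex_minn triclique_system_exists.

End TricliqueNumber.

Section MinimumRank.

(* A finite field, so that the minimum below is over a finite type of
   matrices; the row and column of a vertex u have index enum_rank u. *)
Variables (G : sgraph) (F : finFieldType).

Definition fits (A : 'M[F]_#|vert G|) : bool :=
  (A^T == A)%R &&
  [forall u : G, forall v : G, (u != v) ==>
    ((A (enum_rank u) (enum_rank v) != 0)%R == edge u v)].

Lemma fits_exists : exists r, [exists A, fits A && (\rank A == r)].
Proof.
pose A : 'M[F]_#|vert G| :=
  (\matrix_(i, j) (edge (enum_val i : G) (enum_val j))%:R)%R.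
exists (\rank A); apply/existsP; exists A; rewrite eqxx andbT.
apply/andP; split; first by apply/eqP/matrixP => i j; rewrite !mxE edge_sym.
apply/'forall_forallP => u v; apply/implyP => _.
by rewrite mxE !enum_rankK; case: (edge u v); rewrite ?oner_eq0 ?eqxx.
Qed.

Definition mr : nat := ex_minn fits_exists.

End MinimumRank.

(* Main.v *)
(* Over F_2, a set S with indicator row vector s corresponds to the rank-one
   matrix s^T s, and a triclique (X, Y, Z) to the alternating matrix
   x^T y - y^T x of rank at most 2, where x and y are the indicators of X U Z
   and Y U Z.  Conversely, pivoting on a nonzero diagonal entry splits off one
   square from a symmetric matrix, and pivoting on an off-diagonal entry splits
   off one alternating product from an alternating matrix, lowering the rank by
   1 and 2 respectively.  A symmetric matrix of rank r is thus a sum of r/2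
   alternating products if it is alternating; otherwise it is a sum of r
   squares, since over F_2 a square and an alternating product together are a
   sum of three squares. *)
Require Import Defs.
From mathcomp Require Import all_boot all_order all_algebra.
From mathcomp Require Import ring.

Set Implicit Arguments.
Unset Strict Implicit.
Unset Printing Implicit Defensive.

Import GRing.Theory.

Local Open Scope ring_scope.

(** * Ranks and entries of sums *)

Lemma mxrank_sum_le (F : fieldType) (m n k : nat) (T : Type) (s : seq T)
    (f : T -> 'M[F]_(m, n)) :
  (forall x, \rank (f x) <= k)%N ->
  (\rank (\sum_(x <- s) f x)%R <= k * size s)%N.
Proof.
move=> fk; elim: s => [|x s IHs]; first by rewrite big_nil mxrank0.
rewrite big_cons mulnS (leq_trans (mxrank_add _ _)) ?leq_add //.
Qed.

Lemma sum_count (R : pzSemiRingType) (T : Type) (a : pred T) (C : seq T) :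
  \sum_(c <- C) (a c)%:R = (count a C)%:R :> R.
Proof. by elim: C => [|c C IHC]; rewrite ?big_nil // big_cons IHC -natrD. Qed.

(** * Alternating matrices over a field *)

Section Decomposition.

Variables (F : fieldType) (n : nat).
Implicit Types (A B : 'M[F]_n) (x y v : 'rV[F]_n).

Definition sqmx v : 'M_n := v^T *m v.
Definition altmx x y : 'M_n := x^T *m y - y^T *m x.

Lemma sqmxE v i j : sqmx v i j = v 0 i * v 0 j.
Proof. by rewrite !mxE big_ord1 !mxE. Qed.

Lemma altmxE x y i j : altmx x y i j = x 0 i * y 0 j - y 0 i * x 0 j.
Proof. by rewrite !mxE !big_ord1 !mxE. Qed.

Lemma mxrank_outer x y : (\rank (x^T *m y) <= 1)%N.
Proof. by rewrite (leq_trans (mxrankM_maxr _ _)) ?rank_leq_row. Qed.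

Lemma mxrank_altmx x y : (\rank (altmx x y) <= 2)%N.
Proof.
rewrite (leq_trans (mxrank_add _ _)) // mxrank_opp.
by rewrite (leq_add (mxrank_outer _ _) (mxrank_outer _ _)).
Qed.

Lemma col0_submx (m1 m2 : nat) (B : 'M[F]_(m1, n)) (C : 'M_(m2, n)) j :
  (B <= C)%MS -> col j C = 0 -> col j B = 0.
Proof. by case/submxP=> D ->; rewrite !colE -mulmxA => ->; rewrite mulmx0. Qed.

(** A column that is zero for [C] is zero for every matrix with rows in its row space, so column [j]
    makes the inclusion strict. *)
Lemma rank_lt_of_col (m1 m2 : nat) (B : 'M[F]_(m1, n)) (C : 'M_(m2, n)) j :
  (B <= C)%MS -> col j B = 0 -> col j C != 0 -> (\rank B < \rank C)%N.
Proof.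
move=> BC Bj Cj; apply: rank_ltmx; rewrite /ltmx BC.
by apply: contra Cj => CB; apply/eqP/(col0_submx CB).
Qed.

(** Induction on the rank. In characteristic 2 skew-symmetry does not force a zero diagonal, hence
    the second hypothesis. *)
Lemma altmx_decomposition A : A^T = - A -> (forall i, A i i = 0) ->
  exists2 D : seq ('rV[F]_n * 'rV[F]_n),
    A = \sum_(p <- D) altmx p.1 p.2 & (2 * size D <= \rank A)%N.
Proof.
have [r] := ubnP (\rank A); elim: r A => // r IHr A rA At A0.
have [->|] := eqVneq A 0; first by exists [::]; rewrite ?big_nil ?muln0.
case/matrix0Pn=> i [j a0]; pose a := A i j.
have AC k l : A k l = - A l k by move/matrixP/(_ l k): At; rewrite !mxE.
(* The factor [a^-1] makes columns [i] and [j] of [B] vanish. *)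
pose x := a^-1 *: row i A; pose y := row j A; pose B := A - altmx x y.
have BE k l : B k l = A k l - a^-1 * (A i k * A j l - A j k * A i l).
  by rewrite /B [LHS]mxE [X in _ + X]mxE altmxE !mxE; ring.
have Bi : col i B = 0.
  apply/colP=> k; rewrite mxE BE A0 mulr0 subr0 (AC i k) (AC j i) mulrNN.
  by rewrite mulrC mulfK // subrr mxE.
have Bj : col j B = 0.
  apply/colP=> k; rewrite mxE BE A0 mulr0 sub0r (AC j k) mulNr opprK.
  by rewrite mulrC mulfK // subrr mxE.
have yA : (y <= A)%MS by rewrite row_sub.
have xA : (x <= A)%MS by rewrite scalemx_sub ?row_sub.
have BA : (B <= A)%MS.
  rewrite addmx_sub ?submx_refl // eqmx_opp addmx_sub ?eqmx_opp //;
  by rewrite mulmx_sub.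
(* The rank drops twice, by way of [B] with [row i A] appended: column [j] separates this matrix
   from [B], column [i] separates it from [A]. *)
have rB : (\rank B < \rank (col_mx B (row i A)))%N.
  apply: (@rank_lt_of_col _ _ _ _ j) => //.
    by rewrite -addsmxE addsmxSl.
  rewrite col_col_mx; apply/matrix0Pn; exists (rshift n 0), 0.
  by rewrite col_mxEd !mxE.
have rBx : (\rank (col_mx B (row i A)) < \rank A)%N.
  apply: (@rank_lt_of_col _ _ _ _ i).
  - by rewrite col_mx_sub BA row_sub.
  - rewrite col_col_mx Bi; apply/matrixP => k l; rewrite !mxE.
    by case: split => u; rewrite !mxE ?A0.
  - by apply/matrix0Pn; exists j, 0; rewrite mxE AC oppr_eq0.
have rBA := leq_trans rB (ltnW rBx).
have [|||D DB sD] := IHr B.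
- by rewrite (leq_trans rBA).
- by apply/matrixP => k l; rewrite [LHS]mxE [RHS]mxE !BE (AC l k); ring.
- by move=> k; rewrite BE A0 mulrC (mulrC (A i k)) subrr mul0r subr0.
exists ((x, y) :: D); first by rewrite big_cons -DB addrC subrK.
by rewrite /= mulnS (leq_ltn_trans (leq_ltn_trans sD rB) rBx).
Qed.

End Decomposition.

(** * Sums of squares over F_2 *)

Lemma F2E (a : 'F_2) : a = (a != 0)%:R.
Proof. by case: a => [[|[|]]] // i; apply/val_inj. Qed.

Lemma F2_natr_neq0 k : (k%:R != 0 :> 'F_2) = odd k.
Proof. by rewrite -(dvdn_pcharf (pchar_Fp (erefl : prime 2))) dvdn2 negbK. Qed.

Lemma F2_oppr (a : 'F_2) : - a = a.
Proof. exact: (oppr_pchar2 (pchar_Fp (erefl : prime 2))). Qed.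

Lemma F2_altmx_tr n (x y : 'rV['F_2]_n) : (altmx x y)^T = altmx x y.
Proof. by apply/matrixP=> i j; rewrite mxE !altmxE !F2_oppr; ring. Qed.

(** On expanding the right side, [sqmx v] occurs three times, the products of [x] with [y] once, and
    all other terms twice. *)
Lemma sqmx_add_altmx n (v x y : 'rV['F_2]_n) :
  sqmx v + altmx x y = sqmx (v + x) + sqmx (v + y) + sqmx (v + x + y).
Proof.
apply/matrixP=> i j; rewrite [LHS]mxE [RHS]mxE [X in _ = X + _]mxE.
rewrite altmxE !sqmxE !mxE.
by rewrite (F2E (v 0 i)) (F2E (x 0 i)) (F2E (y 0 i))
  (F2E (v 0 j)) (F2E (x 0 j)) (F2E (y 0 j));
do 6?case: (_ != _); apply/val_inj.
Qed.

(** One square is a carry: two of the three new squares are kept, and [sqmx (v + x)] absorbs the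
    next product. *)
Lemma sqmx_add_sum_altmx n (D : seq ('rV['F_2]_n * 'rV['F_2]_n)) v :
  exists2 C : seq 'rV['F_2]_n,
    sqmx v + \sum_(p <- D) altmx p.1 p.2 = \sum_(w <- C) sqmx w
    & size C = (2 * size D).+1.
Proof.
elim: D v => [|[x y] D IHD] v.
  by exists [:: v]; rewrite // big_nil big_seq1 addr0.
have [C CE sC] := IHD (v + x).
exists [:: v + y, v + x + y & C]; last by rewrite /= sC mulnS.
rewrite !big_cons /= -CE addrA sqmx_add_altmx !addrA; congr (_ + _).
by rewrite [RHS]addrC addrA.
Qed.

Lemma sqmx_decomposition n (A : 'M['F_2]_n) i : A^T = A -> A i i != 0 ->
  exists2 C : seq 'rV['F_2]_n,
    A = \sum_(v <- C) sqmx v & (size C <= \rank A)%N.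
Proof.
have [r] := ubnP (\rank A); elim: r A i => // r IHr A i rA At Aii.
have AC k l : A k l = A l k by rewrite -[in LHS]At mxE.
have Aii1 : A i i = 1 by rewrite (F2E (A i i)) Aii.
pose v := row i A; pose B := A - sqmx v.
have BE k l : B k l = A k l - A i k * A i l.
  by rewrite /B [LHS]mxE [X in _ + X]mxE sqmxE !mxE.
have rB : (\rank B < \rank A)%N.
  apply: (@rank_lt_of_col _ _ _ _ _ _ i).
  - by rewrite addmx_sub ?submx_refl // eqmx_opp mulmx_sub ?row_sub.
  - by apply/colP=> k; rewrite mxE BE Aii1 mulr1 (AC i k) subrr mxE.
  - by apply/matrix0Pn; exists i, 0; rewrite mxE.
have Bt : B^T = B by apply/matrixP=> k l; rewrite mxE !BE AC mulrC.
have AE : A = sqmx v + B by rewrite addrC subrK.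
have [/existsP[j Bj] | /existsPn B0] := boolP [exists j, B j j != 0].
  have [|C CB sC] := IHr B j _ Bt Bj; first by rewrite (leq_trans rB).
  exists (v :: C); first by rewrite big_cons -CB.
  by rewrite /= (leq_ltn_trans sC).
(* [B] is now alternating; its products and [sqmx v] together become at most [\rank B + 1] squares,
   which is at most [\rank A]. *)
have [||D DB sD] := @altmx_decomposition _ _ B.
- by rewrite Bt; apply/matrixP=> k l; rewrite [RHS]mxE F2_oppr.
- by move=> j; apply/eqP; rewrite -[_ == _]negbK B0.
have [C CE sC] := sqmx_add_sum_altmx D v.
by exists C; rewrite ?sC ?(leq_ltn_trans sD) // -CE -DB.
Qed.

(** * Set systems and triclique systems as matrices *)

Section Graphs.

Variable G : sgraph.
Implicit Types (S : {set G}) (u v : G) (x y : 'rV['F_2]_#|G|) (t : triclique G).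

Definition set_row S : 'rV['F_2]_#|G| := \row_i (enum_val i \in S)%:R.
Definition row_set x : {set G} := [set u | x 0 (enum_rank u) != 0].

Lemma set_rowE S u : set_row S 0 (enum_rank u) = (u \in S)%:R.
Proof. by rewrite mxE enum_rankK. Qed.

Lemma row_setK x : set_row (row_set x) = x.
Proof. by apply/rowP=> i; rewrite mxE inE enum_valK -F2E. Qed.

Definition triclique_mx t : 'M['F_2]_#|G| :=
  altmx (set_row (t.1.1 :|: t.2)) (set_row (t.1.2 :|: t.2)).

(** The coordinates of [p.1] and [p.2] at a vertex decide its part: (1,0), (0,1) and (1,1) give X, Y
    and Z. *)
Definition row_triclique (p : 'rV['F_2]_#|G| * 'rV['F_2]_#|G|) : triclique G :=
  (row_set p.1 :\: row_set p.2, row_set p.2 :\: row_set p.1,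
   row_set p.1 :&: row_set p.2).

Lemma row_triclique_is_triclique p : is_triclique (row_triclique p).
Proof.
by rewrite /= -!setI_eq0; apply/and3P; split; apply/eqP/setP=> u;
  rewrite !inE; do 2?case: (_ == _).
Qed.

Lemma row_tricliqueK p : triclique_mx (row_triclique p) = altmx p.1 p.2.
Proof.
rewrite /triclique_mx /= setUC setUC -[in RHS](row_setK p.1) -[in RHS](row_setK p.2).
by congr altmx; congr set_row; apply/setP=> u; rewrite !inE; do 2?case: (_ == _).
Qed.

(** The entry is the determinant of the coordinate pairs of [u] and [v]; over F_2 it is nonzero
    exactly when the pairs are distinct and nonzero, that is, when the vertices lie in different
    parts. *)
Lemma triclique_mxE t u v : is_triclique t ->
  triclique_mx t (enum_rank u) (enum_rank v) = (triclique_adj t u v)%:R.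
Proof.
case: t => [[X Y] Z] /and3P[XY XZ YZ]; rewrite altmxE !set_rowE !inE /=.
have disj (A B : {set G}) :
    [disjoint A & B] -> forall w, ~~ ((w \in A) && (w \in B)).
  by move=> AB w; apply/negP=> /andP[/(disjointFr AB)->].
move: (disj _ _ XY u) (disj _ _ XZ u) (disj _ _ YZ u).
move: (disj _ _ XY v) (disj _ _ XZ v) (disj _ _ YZ v).
by do 6!case: (_ \in _); move=> //= *; apply/val_inj.
Qed.

(** A count is nonzero in F_2 exactly when it is odd; this serves both kinds of system. *)
Lemma fits_count (T : Type) (C : seq T) (f : T -> 'M['F_2]_#|G|)
    (a : G -> G -> pred T) :
  (forall c, (f c)^T = f c) ->
  (forall u v, \sum_(c <- C) f c (enum_rank u) (enum_rank v)
               = (count (a u v) C)%:R) ->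
  fits (\sum_(c <- C) f c)
  = [forall u : G, forall v : G, (u != v) ==> (edge u v == odd (count (a u v) C))].
Proof.
move=> fT fE; rewrite /fits linear_sum (eq_bigr f) ?eqxx //=.
apply: eq_forallb => u; apply: eq_forallb => v.
by rewrite summxE fE F2_natr_neq0 (eq_sym (odd _)).
Qed.

Lemma scs_fits (C : seq {set G}) :
  is_scs C = fits (\sum_(S <- C) sqmx (set_row S)).
Proof.
rewrite (@fits_count _ _ _ (fun u v S => (u \in S) && (v \in S))) //.
  by move=> S; rewrite trmx_mul trmxK.
move=> u v; rewrite -sum_count; apply: eq_bigr => S _.
by rewrite sqmxE !set_rowE -natrM mulnb.
Qed.

Lemma triclique_system_fits (C : seq (triclique G)) :
  all (@is_triclique G) C ->
  is_triclique_system C = fits (\sum_(t <- C) triclique_mx t).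
Proof.
move=> triC; rewrite /is_triclique_system triC.
rewrite (@fits_count _ _ _ (fun u v t => triclique_adj t u v)) //.
  by move=> t; rewrite F2_altmx_tr.
move=> u v; rewrite -sum_count; apply: eq_big_seq => t tC.
by rewrite triclique_mxE // (allP triC).
Qed.

(** * Comparison of the three numbers *)

Lemma mr_le (A : 'M['F_2]_#|G|) : fits A -> (mr G 'F_2 <= \rank A)%N.
Proof.
move=> fA; rewrite /mr; case: ex_minnP => m _; apply.
by apply/existsP; exists A; rewrite fA eqxx.
Qed.

Lemma mr_le_c2 : (mr G 'F_2 <= c2 G)%N.
Proof.
rewrite /c2; case: ex_minnP => m /existsP[C]; rewrite scs_fits => fC _.
rewrite (leq_trans (mr_le fC)) // -[leqRHS]mul1n.
have := @mxrank_sum_le _ _ _ 1 _ C (fun S => sqmx (set_row S))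
  (fun S => mxrank_outer _ _).
by rewrite size_tuple.
Qed.

Lemma mr_le_t2 : (mr G 'F_2 <= 2 * t2 G)%N.
Proof.
rewrite /t2; case: ex_minnP => m /existsP[C] tsC _.
have /andP[triC _] := tsC; rewrite triclique_system_fits // in tsC.
rewrite (leq_trans (mr_le tsC)) //.
have := @mxrank_sum_le _ _ _ 2 _ C triclique_mx (fun t => mxrank_altmx _ _).
by rewrite size_tuple.
Qed.

Lemma c2_le (C : seq 'rV['F_2]_#|G|) :
  fits (\sum_(v <- C) sqmx v) -> (c2 G <= size C)%N.
Proof.
move=> fC; rewrite /c2; case: ex_minnP => m _; apply; apply/existsP.
exists (map_tuple row_set (in_tuple C)); rewrite scs_fits big_map.
by under eq_bigr do rewrite row_setK.
Qed.

Lemma t2_le (D : seq ('rV['F_2]_#|G| * 'rV['F_2]_#|G|)) :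
  fits (\sum_(p <- D) altmx p.1 p.2) -> (t2 G <= size D)%N.
Proof.
move=> fD; rewrite /t2; case: ex_minnP => m _; apply; apply/existsP.
exists (map_tuple row_triclique (in_tuple D)); rewrite triclique_system_fits.
  by rewrite big_map; under eq_bigr do rewrite row_tricliqueK.
by rewrite all_map; apply/allP => p _; apply: row_triclique_is_triclique.
Qed.

(** The diagonal of a fitting matrix of minimum rank decides which number is bounded: [c2 G] if some
    entry is nonzero, [2 * t2 G] otherwise. *)
Lemma min_le_mr : (minn (c2 G) (2 * t2 G) <= mr G 'F_2)%N.
Proof.
rewrite [mr _ _]/mr; case: ex_minnP => _ /existsP[A /andP[fA /eqP <-]] _.
have /andP[/eqP At _] := fA.
have [/existsP[i Ai] | /existsPn A0] := boolP [exists i, A i i != 0].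
  have [C CA sC] := sqmx_decomposition At Ai.
  by rewrite geq_min (leq_trans _ sC) // c2_le -?CA.
have [||D DA sD] := @altmx_decomposition _ _ A.
- by rewrite At; apply/matrixP=> k l; rewrite [RHS]mxE F2_oppr.
- by move=> j; apply/eqP; rewrite -[_ == _]negbK A0.
by rewrite geq_min orbC (leq_trans _ sD) // leq_mul2l t2_le -?DA.
Qed.

End Graphs.

Theorem theorem4p14 (G : sgraph) : mr G 'F_2 = minn (c2 G) (2 * t2 G).
Proof.
apply/eqP; rewrite eqn_leq min_le_mr andbT leq_min.
by rewrite mr_le_c2 mr_le_t2.
Qed.
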